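(* Let $d,D\ge1$ be integers and let $\mathcal X\subset\mathbb R^d$ be nonempty with base point $\mathrm e\in\mathcal X$. For each integer $L\ge2$ let $R_L$ be the extended representation cost of depth-$L$ ReLU networks with weight decay on $\mathrm{Lip}(\mathcal X;\mathbb R^D)$ and $\mathcal F_L=\{f\in\mathrm{Lip}(\mathcal X;\mathbb R^D):R_L(f)<+\infty\}$. Then for every $L\ge2$, $$\mathcal F_L\subset\mathcal F_{L+1}.$$ In particular, for every $f\in\mathcal F_L$, $$R_{L+1}(f)\le\frac{2L}{L+1}R_L(f)+\frac{2D}{L+1}.$$
   Context: **Lipschitz space and weak\* topology.** $\mathcal X\subset\mathbb R^d$ carries the Euclidean metric. $\mathrm{Lip}(\mathcal X;\mathbb R^D)$ is the space of Lipschitz maps $f:\mathcal X\to\mathbb R^D$, with norm $\max\{|f|_{\mathrm{Lip}},\|f(\mathrm e)\|_2\}$, $|f|_{\mathrm{Lip}}=\sup_{x\ne y}\|f(x)-f(y)\|_2/\|x-y\|_2$. The Arens–Eells space $\mathrm{AE}(\mathcal X)$ is the completion of the span of $\{\delta_x-\delta_y:x,y\in\mathcal X\}$ under $\|m\|=\inf\{\sum_i|a_i|\,\|x_i-y_i\|_2: m=\sum_i a_i(\delta_{x_i}-\delta_{y_i})\}$; it is the predual of the scalar Lipschitz functions vanishing at $\mathrm e$, via $\langle\sum_i a_i(\delta_{x_i}-\delta_{y_i}),g\rangle=\sum_i a_i(g(x_i)-g(y_i))$. $\mathrm{Lip}(\mathcal X;\mathbb R^D)$ is isometrically the dual of $(\mathrm{AE}(\mathcal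 X)\widehat\otimes_\pi\mathbb R^D)\oplus_1\mathbb R^D$, and $w^*$ is the corresponding weak\* topology: the coarsest topology making $f\mapsto\langle m,f_j-f_j(\mathrm e)\rangle$ and $f\mapsto f_j(\mathrm e)$ continuous for all components $j$ and all $m\in \mathrm{AE}(\mathcal X)$. **Lower semicontinuous regularization.** A function $K$ on a topological space with values in $[-\infty,+\infty]$ is l.s.c. if all sublevel sets $\{K\le\alpha\}$, $\alpha\in\mathbb R$, are closed. Its l.s.c. regularization is the largest l.s.c. function bounded above by $K$. **Deep ReLU networks.** $\Theta_L$ is the set of tuples $\theta=((W_1,b_1),\dots,(W_L,b_L))$ with $W_\ell\in\mathbb R^{K_{\ell+1}\times K_\ell}$, $b_\ell\in\mathbb R^{K_{\ell+1}}$, $K_1=d$, $K_{L+1}=D$, and arbitrary finite hidden widths $K_2,\dots,K_L\in\mathbb N$. Set $f_\theta=a_L\circ\sigma\circ a_{L-1}\circ\cdots\circ\sigma\circ a_1$ restricted to $\mathcal X$, $a_\ell(z)=W_\ell z+b_\ell$, $\sigma=\max\{0,\cdot\}$ entrywise. The parameter cost is $C_L(\theta)=\frac1L\sum_{\ell=1}^L\|W_\ell\|_F^2$. Define $R_{\Theta_L}(f)=\inf\{C_L(\theta):\theta\in\Theta_L,\ f_\theta=f\}$ for $f\in\mathrm{Lip}(\mathcal X;\mathbb R^D)$ ($\inf\varnothing=+\infty$). $R_L$ is the $w^*$-l.s.c. regularization of $R_{\Theta_L}$ on $\mathrm{Lip}(\mathcal X;\mathbb R^D)$. *)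

(* Defs.v *)
From HB Require Import structures.
From mathcomp Require Import all_boot all_order all_algebra generic_quotient finmap.
From mathcomp Require Import all_classical all_reals all_analysis.

Set Implicit Arguments.
Unset Strict Implicit.
Unset Printing Implicit Defensive.

Import Order.TTheory GRing.Theory Num.Theory.
Import numFieldNormedType.Exports.

Local Open Scope classical_set_scope.
Local Open Scope ring_scope.
Local Open Scope quotient_scope.

(* The library norm on matrices is the sup norm, hence a separate Euclidean
   norm. *)
Definition enorm (R : realType) (n : nat) (v : 'cV[R]_n) : R :=
  Num.sqrt (\sum_i v i 0 ^+ 2).

Section ArensEells.
Context {R : realType} {d : nat} {X : set 'cV[R]_d}.

Definition edist (x y : X) : R := enorm (val x - val y).

Definition lipschitz_scalar (g : X -> R) :=
  exists k : R, forall x y, `|g x - g y| <= k * edist x y.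

(* delta_x, seen as a finitely supported function on X. *)
Definition delta (x : X) : X -> R := fun z => (z == x)%:R.

(* A list of triples (a, x, y) stands for the formal sum of the
   a (delta_x - delta_y). *)
Definition comb (s : seq (R * X * X)) : X -> R :=
  \sum_(p <- s) (fun z => p.1.1 * (delta p.1.2 z - delta p.2 z)).

Definition comb_cost (s : seq (R * X * X)) : R :=
  \sum_(p <- s) `|p.1.1| * edist p.1.2 p.2.

Definition molecule : set (X -> R) := range comb.

Definition ae_norm (m : X -> R) : R :=
  inf [set comb_cost s | s in [set s | m = comb s]].

(* A finite sum, since molecules have finite support; see mpair_comb. *)
Definition mpair (m g : X -> R) : R := \sum_(x \in [set: X]) m x * g x.

Record ae_cauchy := AECauchy {
  ae_seq :> nat -> X -> R;
  ae_seq_molecule : forall n, molecule (ae_seq n);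
  ae_seq_cauchy : forall eps : R, 0 < eps -> exists N : nat,
    forall i j, (N <= i)%N -> (N <= j)%N ->
      ae_norm (ae_seq i - ae_seq j) < eps }.

HB.instance Definition _ := gen_eqMixin ae_cauchy.
HB.instance Definition _ := gen_choiceMixin ae_cauchy.

Definition ae_eqv (u v : ae_cauchy) : bool :=
  `[< ae_norm (u n - v n) @[n --> \oo] --> (0 : R) >].

Lemma enorm_ge0 n (v : 'cV[R]_n) : 0 <= enorm v.
Proof. exact: sqrtr_ge0. Qed.

Lemma enormN n (v : 'cV[R]_n) : enorm (- v) = enorm v.
Proof.
by rewrite /enorm; congr Num.sqrt; apply: eq_bigr => i _; rewrite mxE sqrrN.
Qed.

Lemma comb_cost_ge0 s : 0 <= comb_cost s.
Proof. by apply: sumr_ge0 => p _; rewrite mulr_ge0 ?enorm_ge0. Qed.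

Lemma combD s t : comb (s ++ t) = comb s + comb t.
Proof. by rewrite /comb big_cat. Qed.

Lemma combN s : comb [seq (- p.1.1, p.1.2, p.2) | p <- s] = - comb s.
Proof.
rewrite /comb big_map -sumrN; apply: eq_bigr => p _ /=.
by apply/funext => z /=; rewrite fctE mulNr.
Qed.

Lemma comb_costN s :
  comb_cost [seq (- p.1.1, p.1.2, p.2) | p <- s] = comb_cost s.
Proof.
by rewrite /comb_cost big_map; apply: eq_bigr => p _ /=; rewrite normrN.
Qed.

Lemma moleculeB m m' : molecule m -> molecule m' -> molecule (m - m').
Proof.
move=> [s _ <-] [t _ <-].
by exists (s ++ [seq (- p.1.1, p.1.2, p.2) | p <- t]) => //; rewrite combD combN.
Qed.

Lemma ae_norm_has_lbound m :
  has_lbound [set comb_cost s | s in [set s | m = comb s]].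
Proof. by exists 0 => _ [s _ <-]; exact: comb_cost_ge0. Qed.

Lemma ae_norm_le m s : m = comb s -> ae_norm m <= comb_cost s.
Proof.
by move=> ms; apply: ge_inf; [exact: ae_norm_has_lbound|exists s].
Qed.

Lemma ae_norm_lt m (c : R) : molecule m -> ae_norm m < c ->
  exists2 s, m = comb s & comb_cost s < c.
Proof.
move=> [s0 _ s0m] mc.
have [|_ [s ms <-] sc] := inf_lt _ mc; last by exists s.
by exists (comb_cost s0), s0.
Qed.

Lemma ae_norm_ge0 m : 0 <= ae_norm m.
Proof.
rewrite /ae_norm.
have [->|/set0P ne] := eqVneq [set comb_cost s | s in [set s | m = comb s]] set0.
  by rewrite inf0.
by apply: lb_le_inf => // _ [s _ <-]; exact: comb_cost_ge0.
Qed.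

Lemma ae_norm0 : ae_norm 0 = 0.
Proof.
apply/eqP; rewrite eq_le ae_norm_ge0 andbT.
have -> : 0 = comb_cost [::] by rewrite /comb_cost big_nil.
by apply: ae_norm_le; rewrite /comb big_nil.
Qed.

Lemma ae_normN m : ae_norm (- m) = ae_norm m.
Proof.
congr inf; apply/seteqP; split=> _ [s /= ms <-];
  exists [seq (- p.1.1, p.1.2, p.2) | p <- s];
  by rewrite ?comb_costN//= combN -ms ?opprK.
Qed.

Lemma ae_norm_triangle m m' : molecule m -> molecule m' ->
  ae_norm (m + m') <= ae_norm m + ae_norm m'.
Proof.
move=> mm mm'; apply/ler_addgt0Pr => eps eps0.
have e2 : 0 < eps / 2 by rewrite divr_gt0.
have [s ms sc] := ae_norm_lt mm (ltr_pwDr e2 (lexx (ae_norm m))).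
have [t mt tc] := ae_norm_lt mm' (ltr_pwDr e2 (lexx (ae_norm m'))).
have /ae_norm_le/le_trans : m + m' = comb (s ++ t) by rewrite combD ms mt.
apply; rewrite [eps]splitr addrACA /comb_cost big_cat/=.
by rewrite lerD// ltW.
Qed.

Lemma ae_eqv_refl : reflexive ae_eqv.
Proof.
move=> u; apply/asboolP.
by under eq_fun do rewrite subrr ae_norm0; exact: cvg_cst.
Qed.

Lemma ae_eqv_sym : symmetric ae_eqv.
Proof.
by move=> u v; rewrite /ae_eqv; under eq_fun do rewrite -ae_normN opprB.
Qed.

Lemma ae_eqv_trans : transitive ae_eqv.
Proof.
move=> v u w /asboolP uv /asboolP vw; apply/asboolP.
have uvw : ae_norm (u n - v n) + ae_norm (v n - w n) @[n --> \oo] --> (0 : R).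
  by rewrite -[0 : R]addr0; exact: cvgD.
apply: (squeeze_cvgr _ (cvg_cst 0) uvw).
apply: nearW => n; rewrite ae_norm_ge0/=.
rewrite -[u n - w n](subrKA (v n)); apply: ae_norm_triangle;
  by apply: moleculeB; exact: ae_seq_molecule.
Qed.

Canonical ae_equiv := EquivRel ae_eqv ae_eqv_refl ae_eqv_sym ae_eqv_trans.

(* The Arens-Eells space as the completion of the space of molecules: Cauchy
   sequences modulo sequences of norm tending to 0. *)
Definition AE := {eq_quot ae_equiv}.

(* The choice of representative is immaterial for Lipschitz g: ae_pair_cvg. *)
Definition ae_pair (m : AE) (g : X -> R) : R :=
  limn (fun n => mpair (repr m n) g).

Lemma fset_delta_sum (x : X) (g : X -> R) (A : {fset X}) : x \in A ->
  \sum_(z <- A) delta x z * g z = g x.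
Proof.
move=> xA; rewrite (big_fsetD1 x)//= /delta eqxx mul1r big1_fset ?addr0// => z.
by rewrite !inE => /andP[/negPf -> _]; rewrite mul0r.
Qed.

Lemma mpair_comb (s : seq (R * X * X)) (g : X -> R) :
  mpair (comb s) g = \sum_(p <- s) p.1.1 * (g p.1.2 - g p.2).
Proof.
pose A : {fset X} := [fset z in [seq p.1.2 | p <- s] ++ [seq p.2 | p <- s]]%fset.
have combE z : comb s z = \sum_(p <- s) p.1.1 * (delta p.1.2 z - delta p.2 z).
  by rewrite /comb fct_sumE.
have in1 p : p \in s -> p.1.2 \in A.
  by move=> ps; rewrite !inE (map_f (fun p => p.1.2) ps).
have in2 p : p \in s -> p.2 \in A.
  by move=> ps; rewrite !inE (map_f (fun p => p.2) ps) orbT.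
rewrite /mpair (fsbigTE A); last first.
  move=> z zA; rewrite combE big_seq big1 ?mul0r// => p ps.
  rewrite /delta; case: eqVneq => [zp|_].
    by move: zA; rewrite zp in1.
  case: eqVneq => [zp|_]; first by move: zA; rewrite zp in2.
  by rewrite subrr mulr0.
under eq_bigr do rewrite combE mulr_suml.
rewrite exchange_big/= big_seq [RHS]big_seq; apply: eq_bigr => p ps.
under eq_bigr do rewrite -mulrA mulrBl.
by rewrite -mulr_sumr sumrB !fset_delta_sum ?in1 ?in2.
Qed.

Lemma mpair_bound (g : X -> R) (k : R) (m : X -> R) :
  (forall x y, `|g x - g y| <= k * edist x y) -> 0 < k -> molecule m ->
  `|mpair m g| <= k * ae_norm m.
Proof.
move=> gk k0 mm; rewrite mulrC -ler_pdivrMr//; apply/ler_addgt0Pr => eps eps0.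
have [s ms sc] := ae_norm_lt mm (ltr_pwDr eps0 (lexx (ae_norm m))).
apply: le_trans (ltW sc); rewrite ler_pdivrMr// ms mpair_comb mulrC.
apply: (le_trans (ler_norm_sum _ _ _)); rewrite /comb_cost mulr_sumr.
by apply: ler_sum => p _; rewrite normrM mulrCA ler_wpM2l.
Qed.

Lemma mpairB (m m' g : X -> R) : molecule m -> molecule m' ->
  mpair (m - m') g = mpair m g - mpair m' g.
Proof.
move=> [s _ <-] [t _ <-]; rewrite -combN -combD !mpair_comb big_cat/=; congr (_ + _).
by rewrite big_map -sumrN; apply: eq_bigr => p _ /=; rewrite mulNr.
Qed.

Lemma lipschitz_scalar_pos (g : X -> R) : lipschitz_scalar g ->
  exists2 k : R, 0 < k & forall x y, `|g x - g y| <= k * edist x y.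
Proof.
move=> [k gk]; exists (`|k| + 1); first by rewrite ltr_wpDl.
move=> x y; apply: le_trans (gk x y) _; rewrite ler_wpM2r ?enorm_ge0//.
by rewrite (le_trans (ler_norm k))// lerDl.
Qed.

Lemma ae_pair_cvg (u : ae_cauchy) (g : X -> R) : lipschitz_scalar g ->
  mpair (u n) g @[n --> \oo] --> ae_pair (\pi_AE u) g.
Proof.
move=> /lipschitz_scalar_pos[k k0 gk].
set v := repr (\pi_AE u).
have vcvg : cvgn (fun n => mpair (v n) g).
  apply: cauchy_cvg; apply: cauchy_exP => eps eps0.
  have [N vN] := ae_seq_cauchy v (divr_gt0 eps0 k0).
  exists (mpair (v N) g); exists N => // n /= Nn.
  rewrite -ball_normE /ball_/= -mpairB; [|exact: ae_seq_molecule..].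
  apply: le_lt_trans (mpair_bound gk k0 _) _.
    by apply: moleculeB; exact: ae_seq_molecule.
  by rewrite mulrC -ltr_pdivlMr// vN.
have /eqmodP/asboolP uv : u = v %[mod AE] by rewrite reprK.
have kcvg : k * ae_norm (u n - v n) @[n --> \oo] --> (0 : R).
  by rewrite -[0 : R](mulr0 k); apply: cvgM; [exact: cvg_cst|exact: uv].
have dcvg : mpair (u n) g - mpair (v n) g @[n --> \oo] --> (0 : R).
  apply: norm_cvg0; apply: (squeeze_cvgr _ (cvg_cst 0) kcvg).
  apply: nearW => n; rewrite normr_ge0/= -mpairB; [|exact: ae_seq_molecule..].
  apply: (mpair_bound gk k0).
  by apply: moleculeB; exact: ae_seq_molecule.
rewrite (_ : (fun n => mpair (u n) g) =
  (fun n => (mpair (u n) g - mpair (v n) g) + mpair (v n) g)); last first.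
  by apply/funext => n; rewrite subrK.
by rewrite -[ae_pair _ _]add0r; exact: cvgD.
Qed.

End ArensEells.
Arguments AE {R d} X.

Section Lipschitz.
Context {R : realType} {d : nat} {X : set 'cV[R]_d}.

Record lip_map (D : nat) := LipMap {
  lip_fun :> X -> 'cV[R]_D;
  lip_prop : exists k : R, forall x y,
    enorm (lip_fun x - lip_fun y) <= k * edist x y }.

(* The base point only selects the topology put on the type below. *)
Definition lip (e : X) (D : nat) : Type := lip_map D.

Context (e : X) (D : nat).

HB.instance Definition _ := gen_eqMixin (lip e D).
HB.instance Definition _ := gen_choiceMixin (lip e D).

Variant functional :=
| PairAE of AE X & 'I_D
| EvalBase of 'I_D.

Definition functional_eval (phi : functional) (f : lip e D) : R :=
  match phi with
  | PairAE m j => ae_pair m (fun x => f x j 0 - f e j 0)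
  | EvalBase j => f e j 0
  end.

Lemma functional_lipschitz (f : lip e D) (j : 'I_D) :
  lipschitz_scalar (fun x => f x j 0 - f e j 0).
Proof.
have [k fk] := lip_prop f; exists k => x y; apply: le_trans (fk x y).
rewrite opprB addrA subrK -[leLHS]ger0_norm// -sqrtr_sqr ler_wsqrtr//.
rewrite (bigD1 j)//= !mxE real_normK ?num_real// lerDl.
by apply: sumr_ge0 => i _; exact: sqr_ge0.
Qed.

(* The weak-star topology, i.e. the coarsest one making every functional_eval
   continuous: the supremum of the initial topologies. *)
HB.instance Definition _ := Topological.copy (lip e D)
  (sup_topology (fun phi : functional =>
    Topological.class (initial_topology (functional_eval phi)))).

Lemma functional_continuous (phi : functional) :
  continuous (functional_eval phi).
Proof.
move=> f.
have /cvg_sup/(_ phi) : nbhs f --> f by exact: cvg_id.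
move=> ff; apply: cvg_trans (@initial_continuous _ _ (functional_eval phi) f).
exact: cvg_app.
Qed.

Lemma wstar_coarsest (T : topologicalType) (h : T -> lip e D) :
  (forall phi, continuous (functional_eval phi \o h)) -> continuous h.
Proof.
move=> ch t; apply/cvg_sup => phi A; rewrite (@nbhsE (initial_topology _)).
move=> [_ [[U oU <-] Ut] UA]; apply: filterS UA _; apply: (ch phi t U).
exact: open_nbhs_nbhs.
Qed.

End Lipschitz.

Section LowerSemicontinuous.
Context {R : realType} {T : topologicalType}.
Implicit Types K H : T -> \bar R.

Definition lsc K := forall a : R, closed [set x | (K x <= a%:E)%E].

Definition lsc_reg K (x : T) : \bar R :=
  ereal_sup [set H x | H in [set H | lsc H /\ forall y, (H y <= K y)%E]].

Lemma lsc_lower_semicontinuous K : lsc K <-> lower_semicontinuous K.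
Proof.
rewrite lower_semicontinuousP; split=> KK a.
  rewrite (_ : [set x | _] = ~` [set x | (K x <= a%:E)%E]).
    by apply: closed_openC; exact: KK.
  by apply/seteqP; split=> x /=; rewrite ltNge => /negP.
rewrite (_ : [set x | _] = ~` [set x | (K x > a%:E)%E]).
  by apply: open_closedC; exact: KK.
by apply/seteqP; split=> x /=; rewrite leNgt => /negP.
Qed.

Lemma lsc_reg_lsc K : lsc (lsc_reg K).
Proof.
move=> a; rewrite (_ : [set x | _] =
  \bigcap_(H in [set H | lsc H /\ forall y, (H y <= K y)%E])
    [set x | (H x <= a%:E)%E]).
  by apply: closed_bigI => H [HH _]; exact: HH.
apply/seteqP; split=> x /=.
  by move=> xa H HK; apply: le_trans xa; apply: ereal_sup_ubound; exists H.
by move=> xa; apply: ge_ereal_sup => _ [H HK <-]; exact: xa.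
Qed.

Lemma lsc_reg_le K x : (lsc_reg K x <= K x)%E.
Proof. by apply: ge_ereal_sup => _ [H [_ HK] <-]; exact: HK. Qed.

Lemma lsc_reg_max K H x : lsc H -> (forall y, (H y <= K y)%E) ->
  (H x <= lsc_reg K x)%E.
Proof. by move=> HH HK; apply: ereal_sup_ubound; exists H. Qed.

End LowerSemicontinuous.

Section Networks.
Context {R : realType}.

Definition relu n (z : 'cV[R]_n) : 'cV[R]_n := map_mx (Num.max 0) z.

Definition frobenius_sq m n (W : 'M[R]_(m, n)) : R := \sum_i \sum_j W i j ^+ 2.

(* net D L d: parameters of depth L from R^d to R^D. The innermost affine layer
   comes first and the hidden widths are existentially packed. *)
Inductive net (D : nat) : nat -> nat -> Type :=
| Output d of 'M[R]_(D, d) & 'cV[R]_D : net D 1 d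
| Hidden L d k of 'M[R]_(k, d) & 'cV[R]_k & net D L k : net D L.+1 d.

Fixpoint realization D L d (theta : net D L d) : 'cV[R]_d -> 'cV[R]_D :=
  match theta with
  | Output _ W b => fun z => W *m z + b
  | Hidden _ _ _ W b theta' => fun z => realization theta' (relu (W *m z + b))
  end.

Fixpoint sum_frobenius_sq D L d (theta : net D L d) : R :=
  match theta with
  | Output _ W _ => frobenius_sq W
  | Hidden _ _ _ W _ theta' => frobenius_sq W + sum_frobenius_sq theta'
  end.

Definition net_cost D L d (theta : net D L d) : R :=
  L%:R^-1 * sum_frobenius_sq theta.

Context {d : nat} {X : set 'cV[R]_d} {e : X} {D : nat} (L : nat).

Definition param_cost (f : lip e D) : \bar R :=
  ereal_inf [set (net_cost theta)%:E | theta in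
    [set theta : net D L d | forall x : X, realization theta (val x) = f x]].

Definition rep_cost : lip e D -> \bar R := lsc_reg param_cost.

Definition finite_rep_cost : set (lip e D) := [set f | (rep_cost f < +oo)%E].

End Networks.
Arguments finite_rep_cost {R d X} e D L.

(* Main.v *)
Require Import Defs.
From mathcomp Require Import all_boot all_order all_algebra.
From mathcomp Require Import all_classical all_reals all_analysis.
From mathcomp Require Import ring.

Set Implicit Arguments.
Unset Strict Implicit.
Unset Printing Implicit Defensive.

Import Order.TTheory GRing.Theory Num.Theory.

Local Open Scope classical_set_scope.
Local Open Scope ring_scope.

(** Since z = relu z - relu (- z), the output layer (W, b) of a network can be
    replaced by a hidden layer of width 2D with weights (W, - W) and biases
    (b, - b), followed by the output layer (1, - 1).  This adds |W|^2 + 2D to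
    the sum of the squared Frobenius norms, hence at most doubles that sum up to
    2D.  The resulting affine bound between the parameter costs passes to the
    l.s.c. regularizations, because increasing affine bijections preserve
    lower semicontinuity. *)

(** Valid for infinite [x] and [y] too, since [a] and [c] are real. It isolates the right-hand
    infimum or regularization, so that its extremal property applies. *)
Lemma lee_affineP (R : realType) (a c : R) (x y : \bar R) : 0 < a ->
  (a^-1%:E * (x - c%:E) <= y)%E = (x <= a%:E * y + c%:E)%E.
Proof. by move=> a0; rewrite lee_pdivrMl// leeBlDr. Qed.

Lemma lsc_reg_affine (R : realType) (T : topologicalType)
    (K K' : T -> \bar R) (a c : R) : 0 < a ->
  (forall y, (K' y <= a%:E * K y + c%:E)%E) ->
  forall x, (lsc_reg K' x <= a%:E * lsc_reg K x + c%:E)%E.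
Proof.
move=> a0 KK' x; apply: ge_ereal_sup => _ [H [Hlsc HK'] <-].
rewrite -lee_affineP//.
apply: (@lsc_reg_max _ _ K (fun y => a^-1%:E * (H y - c%:E))%E) => [b|y].
  (* The sublevel set at [b] of this candidate minorant of [K] is that of [H] at [a * b + c]. *)
  by under eq_set do rewrite lee_affineP// -EFinM -EFinD; exact: Hlsc.
by rewrite lee_affineP//; exact: le_trans (HK' y) (KK' y).
Qed.

Section Deepening.
Context {R : realType}.

Lemma frobenius_sq_ge0 m n (W : 'M[R]_(m, n)) : 0 <= frobenius_sq W.
Proof. by do 2!apply: sumr_ge0 => ? _; exact: sqr_ge0. Qed.

Lemma frobenius_sqN m n (W : 'M[R]_(m, n)) :
  frobenius_sq (- W) = frobenius_sq W.
Proof. by do 2!apply: eq_bigr => ? _; rewrite mxE sqrrN. Qed.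

Lemma frobenius_sq_col_mx m1 m2 n (A : 'M[R]_(m1, n)) (B : 'M[R]_(m2, n)) :
  frobenius_sq (col_mx A B) = frobenius_sq A + frobenius_sq B.
Proof.
rewrite /frobenius_sq big_split_ord /=.
by congr (_ + _); do 2!apply: eq_bigr => ? _; rewrite ?col_mxEu ?col_mxEd.
Qed.

Lemma frobenius_sq_row_mx m n1 n2 (A : 'M[R]_(m, n1)) (B : 'M[R]_(m, n2)) :
  frobenius_sq (row_mx A B) = frobenius_sq A + frobenius_sq B.
Proof.
rewrite /frobenius_sq -big_split /=; apply: eq_bigr => i _.
rewrite big_split_ord /=.
by congr (_ + _); apply: eq_bigr => ? _; rewrite ?row_mxEl ?row_mxEr.
Qed.

Lemma frobenius_sq1 n : frobenius_sq (1%:M : 'M[R]_n) = n%:R.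
Proof.
rewrite /frobenius_sq -[in RHS](card_ord n) -sumr_const; apply: eq_bigr => i _.
rewrite (bigD1 i)//= mxE eqxx expr1n big1 ?addr0// => j /negPf ji.
by rewrite mxE eq_sym ji expr0n.
Qed.

Lemma reluBN n (z : 'cV[R]_n) : relu z - relu (- z) = z.
Proof.
apply/matrixP => i j; rewrite !mxE.
(* Writing 0 as - 0 turns max 0 (- z) into - min 0 z; then max 0 z + min 0 z = 0 + z. *)
rewrite -[X in Num.max X (- _)]oppr0 -oppr_min opprK.
by rewrite addr_max_min add0r.
Qed.

Fixpoint deepen D L d (theta : net D L d) : net (R := R) D L.+1 d :=
  match theta with
  | Output _ W b =>
      Hidden (col_mx W (- W)) (col_mx b (- b))
        (Output (row_mx 1%:M (- 1%:M)) 0)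
  | Hidden _ _ _ W b theta' => Hidden W b (deepen theta')
  end.

Lemma realization_deepen D L d (theta : net (R := R) D L d) :
  realization (deepen theta) =1 realization theta.
Proof.
elim: theta => [{}d W b|{}L {}d k W b theta IH] z /=; last exact: IH.
rewrite mul_col_mx add_col_mx mulNmx -opprD /relu map_col_mx mul_row_col.
by rewrite mulNmx !mul1mx addr0; exact: reluBN.
Qed.

(** Equality holds at an output layer, which alone is duplicated; every hidden layer is kept and
    leaves a slack of [frobenius_sq W]. *)
Lemma sum_frobenius_sq_deepen D L d (theta : net (R := R) D L d) :
  sum_frobenius_sq (deepen theta) <= 2 * sum_frobenius_sq theta + 2 * D%:R.
Proof.
elim: theta => [{}d W b|{}L {}d k W b theta IH] /=.
  by rewrite frobenius_sq_col_mx frobenius_sq_row_mx !frobenius_sqN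
    frobenius_sq1 !mulr_natl !mulr2n.
rewrite mulrDr -addrA lerD// mulr_natl mulr2n lerDl; exact: frobenius_sq_ge0.
Qed.

(** The factor L / (L + 1) converts the mean over L layers into one over L + 1 layers. *)
Lemma net_cost_deepen D L d (theta : net (R := R) D L d) : (0 < L)%N ->
  net_cost (deepen theta) <=
    2 * L%:R / L.+1%:R * net_cost theta + 2 * D%:R / L.+1%:R.
Proof.
move=> L0; rewrite [leRHS](_ : _ =
    L.+1%:R^-1 * (2 * sum_frobenius_sq theta + 2 * D%:R)).
  by rewrite ler_wpM2l ?invr_ge0// sum_frobenius_sq_deepen.
by rewrite /net_cost; field; rewrite nat1r !pnatr_eq0 -!lt0n L0.
Qed.

Lemma param_cost_succ d (X : set 'cV[R]_d) (e : X) D L (f : lip e D) :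
  (0 < L)%N ->
  (param_cost L.+1 f <=
    (2 * L%:R / L.+1%:R)%:E * param_cost L f + (2 * D%:R / L.+1%:R)%:E)%E.
Proof.
move=> L0; have a0 : 0 < 2 * L%:R / L.+1%:R :> R.
  by rewrite divr_gt0// mulr_gt0// ltr0n.
(* If no network of depth [L] realizes [f], the infimum is [+oo] and nothing remains to check. *)
rewrite -lee_affineP//; apply: le_ereal_inf_tmp => _ [theta thetaf <-].
rewrite lee_affineP// -EFinM -EFinD.
apply: le_trans (_ : (net_cost (deepen theta))%:E <= _)%E.
  apply: ereal_inf_lbound; exists (deepen theta) => // x.
  by rewrite realization_deepen.
by rewrite lee_fin net_cost_deepen.
Qed.

End Deepening.

Theorem theorem9p8 (R : realType) (d D : nat) (hd : (1 <= d)%N) (hD : (1 <= D)%N)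
    (X : set 'cV[R]_d) (e : X) (L : nat) (hL : (2 <= L)%N) :
  finite_rep_cost e D L `<=` finite_rep_cost e D L.+1 /\
  forall f : lip e D, finite_rep_cost e D L f ->
    (rep_cost L.+1 f <=
      (2 * L%:R / L.+1%:R)%:E * rep_cost L f + (2 * D%:R / L.+1%:R)%:E)%E.
Proof.
have L0 : (0 < L)%N by exact: ltnW.
have a0 : 0 < 2 * L%:R / L.+1%:R :> R by rewrite divr_gt0// mulr_gt0// ltr0n.
(* Proved for all [f], finite cost or not; the inclusion is then read off from it. *)
have RL (f : lip e D) : (rep_cost L.+1 f <=
    (2 * L%:R / L.+1%:R)%:E * rep_cost L f + (2 * D%:R / L.+1%:R)%:E)%E.
  by apply: lsc_reg_affine => // g; exact: param_cost_succ.
split=> [f|f _]; last exact: RL.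
rewrite /finite_rep_cost /= => fL; apply: le_lt_trans (RL f) _.
by rewrite lte_add_pinfty ?ltry// lte_mul_pinfty ?lee_fin ?ltW.
Qed.
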